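(* Let $\Bbbk$ be a field of characteristic $0$ and let $n\ge2$. Let $P_n$ be the path graph with vertex set $[n]=\{1,\dots,n\}$ and edge set $\{\{i,i+1\}: 1\le i\le n-1\}$. Then the algebra $A_{\mathrm c}(P_n)$ has the weak Lefschetz property (WLP) if and only if $n$ is odd or $n\le5$.
   Context: A vertex cover of a graph $G$ is a set of vertices meeting every edge. For a finite simple graph $G$ on $[n]$, let $R=\Bbbk[x_1,\dots,x_n]$ with the standard grading, $x_C=\prod_{i\in C}x_i$, $J(G)=(x_C : C\text{ a vertex cover of }G)\subset R$, and $A_{\mathrm c}(G)=R/\big((x_1^2,\dots,x_n^2)+J(G)\big)$. A standard graded Artinian $\Bbbk$-algebra $A=\bigoplus_i[A]_i$ has the WLP if there is a linear form $\ell\in[A]_1$ such that for every $i$ the multiplication map $\cdot\ell:[A]_i\to[A]_{i+1}$ is injective or surjective. *)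

(* Defs.v *)
From HB Require Import structures.
From mathcomp Require Import all_boot all_algebra.
From mathcomp Require Import generic_quotient ring_quotient.
From mathcomp Require Import boolp.
From mathcomp Require Import mpoly.

Set Implicit Arguments.
Unset Strict Implicit.
Unset Printing Implicit Defensive.

Import GRing.Theory.
Local Open Scope ring_scope.
Local Open Scope quotient_scope.

Section Ideals.
Variable R : comNzRingType.

Definition ideal_gen (S : R -> Prop) (p : R) : Prop :=
  exists s : seq (R * R),
    (forall a, a \in s -> S a.2) /\ p = \sum_(a <- s) a.1 * a.2.

Definition ideal_add (I J : R -> Prop) (p : R) : Prop :=
  exists q r, [/\ I q, J r & p = q + r].

Definition ideal_closed (I : R -> Prop) : Prop :=
  [/\ I 0, forall p q, I p -> I q -> I (p + q)
    & forall a p, I p -> I (a * p)].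

Lemma ideal_gen_closed S : ideal_closed (ideal_gen S).
Proof.
split=> [|p q [s [hs ->]] [t [ht ->]]|a p [s [hs ->]]].
- by exists [::]; split=> //; rewrite big_nil.
- exists (s ++ t); split; last by rewrite big_cat.
  by move=> b; rewrite mem_cat => /orP[/hs|/ht].
- exists [seq (a * b.1, b.2) | b <- s]; split.
    by move=> b /mapP[c /hs hc ->].
  by rewrite big_map mulr_sumr; apply: eq_bigr => b _; rewrite mulrA.
Qed.

Lemma ideal_add_closed I J :
  ideal_closed I -> ideal_closed J -> ideal_closed (ideal_add I J).
Proof.
move=> [I0 ID IM] [J0 JD JM]; split.
- by exists 0, 0; rewrite addr0.
- move=> _ _ [q [r [Iq Jr ->]]] [q' [r' [Iq' Jr' ->]]].
  by exists (q + q'), (r + r'); split; [exact: ID|exact: JD|rewrite addrACA].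
- move=> a _ [q [r [Iq Jr ->]]].
  by exists (a * q), (a * r); split; [exact: IM|exact: JM|rewrite mulrDr].
Qed.

End Ideals.

(* Unlike [idealr], this allows the unit ideal, so that the quotient may be
   the zero ring (as happens for A_c of an edgeless graph). *)
Record ideal (R : comNzRingType) := Ideal {
  ideal_mem :> R -> Prop;
  idealP : ideal_closed ideal_mem }.

Section Quotient.
Variables (R : comNzRingType) (I : ideal R).

Definition ideal_pred : {pred R} := fun p => `[< I p >].

Lemma ideal_pred_zmod_closed : zmod_closed ideal_pred.
Proof.
have [I0 ID IM] := idealP I.
split=> [|p q /asboolP Ip /asboolP Iq]; apply/asboolP => //.
by rewrite -mulN1r; apply/ID/IM.
Qed.
HB.instance Definition _ := GRing.isZmodClosed.Build R ideal_pred
  ideal_pred_zmod_closed.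

Definition quo : Type := Quotient.quot ideal_pred.
HB.instance Definition _ := GRing.Zmodule.on quo.
HB.instance Definition _ := EqQuotient.on quo.

Definition quo_pi (p : R) : quo := \pi p.

Lemma quo_piP p q : quo_pi p = quo_pi q <-> I (p - q).
Proof.
have E : (p - q \in ideal_pred) = (quo_pi p == quo_pi q).
  exact: Quotient.idealrBE.
by split=> [/eqP|h]; [rewrite -E => /asboolP|apply/eqP; rewrite -E; apply/asboolP].
Qed.

Lemma quo_piK (x : quo) : quo_pi (repr x) = x.
Proof. exact: reprK. Qed.

Definition quo_one : quo := quo_pi 1.
Definition quo_mul (x y : quo) : quo := quo_pi (repr x * repr y).

Lemma quo_pi_mul p q : quo_pi (p * q) = quo_mul (quo_pi p) (quo_pi q).
Proof.
have [_ ID IM] := idealP I.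
have h r : I (r - repr (quo_pi r)) by apply/quo_piP; rewrite quo_piK.
apply/quo_piP; rewrite -[p * q](addrNK (p * repr (quo_pi q))) -mulrBr.
by rewrite -addrA -mulrBl; apply/ID/(_ : I (_ * _)); [exact/IM|rewrite mulrC; exact/IM].
Qed.

Lemma quo_pi_add p q : quo_pi (p + q) = quo_pi p + quo_pi q.
Proof. exact: (raddfD (\pi_(Quotient.quot ideal_pred))). Qed.

Lemma quo_mulA : associative quo_mul.
Proof.
by move=> x y z; rewrite -[x]quo_piK -[y]quo_piK -[z]quo_piK -!quo_pi_mul mulrA.
Qed.
Lemma quo_mulC : commutative quo_mul.
Proof. by move=> x y; rewrite /quo_mul mulrC. Qed.
Lemma quo_mul1 : left_id quo_one quo_mul.
Proof. by move=> x; rewrite -[x]quo_piK -quo_pi_mul mul1r. Qed.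
Lemma quo_mulDl : left_distributive quo_mul +%R.
Proof.
move=> x y z; rewrite -[x]quo_piK -[y]quo_piK -[z]quo_piK.
by rewrite -quo_pi_add -!quo_pi_mul mulrDl quo_pi_add.
Qed.
HB.instance Definition _ := GRing.Zmodule_isComPzRing.Build quo
  quo_mulA quo_mulC quo_mul1 quo_mulDl.

End Quotient.

Section Graded.
Variables (k : fieldType) (n : nat).

(* The degree-i component of k[x_1,..,x_n]/I: the image of the forms of
   degree i (0 being homogeneous of every degree). *)
Definition quo_piece (I : ideal {mpoly k[n]}) (i : nat) (x : quo I) : Prop :=
  exists2 p : {mpoly k[n]}, p \is i.-homog & x = quo_pi I p.

End Graded.

(* [piece i] is the component [A]_i. Only the additive and multiplicative
   structure of A enters: the scalars are absorbed in [A]_1, and negative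
   degrees are vacuous. *)
Definition WLP (A : pzRingType) (piece : nat -> A -> Prop) : Prop :=
  exists2 l : A, piece 1%N l &
    forall i : nat,
      (forall x y, piece i x -> piece i y -> l * x = l * y -> x = y)
      \/ (forall z, piece i.+1 z -> exists2 x, piece i x & l * x = z).

(* The vertex i : 'I_n, with values 0, ..., n - 1, stands for i + 1 in [n]. *)
Record sgraph (n : nat) := SGraph {
  adj :> rel 'I_n;
  adj_sym : ssrbool.symmetric adj;
  adj_irr : irreflexive adj }.

Definition vertex_cover n (G : sgraph n) (C : {set 'I_n}) : Prop :=
  forall i j, G i j -> (i \in C) || (j \in C).

Definition path_adj n : rel 'I_n :=
  fun i j => (i.+1 == j :> nat) || (j.+1 == i :> nat).

Lemma path_adj_sym n : ssrbool.symmetric (@path_adj n).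
Proof. by move=> i j; rewrite /path_adj orbC. Qed.

Lemma path_adj_irr n : irreflexive (@path_adj n).
Proof. by move=> i; rewrite /path_adj orbb gtn_eqF. Qed.

Definition path_graph n : sgraph n := SGraph (@path_adj_sym n) (@path_adj_irr n).

Section CoverAlgebra.
Variables (k : fieldType) (n : nat) (G : sgraph n).

Definition cover_monomial (C : {set 'I_n}) : {mpoly k[n]} := \prod_(i in C) 'X_i.

Definition cover_ideal : {mpoly k[n]} -> Prop :=
  ideal_gen (fun p => exists2 C, vertex_cover G C & p = cover_monomial C).

Definition squares_ideal : {mpoly k[n]} -> Prop :=
  ideal_gen (fun p => exists i : 'I_n, p = 'X_i ^+ 2).

Definition Ac_ideal : ideal {mpoly k[n]} :=
  Ideal (ideal_add_closed (ideal_gen_closed _ : ideal_closed squares_ideal)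
                          (ideal_gen_closed _ : ideal_closed cover_ideal)).

Definition Ac := quo Ac_ideal.
HB.instance Definition _ := GRing.ComPzRing.on Ac.

Definition Ac_piece : nat -> Ac -> Prop := @quo_piece k n Ac_ideal.

End CoverAlgebra.

(* Main.v *)
(** The squarefree monomials [x_C], [C] not a vertex cover, form a basis of
    [A_c(G)], so [A_c(G)] is the Boolean lattice algebra
    [B = k[x]/(x_1^2, ..., x_n^2)] with the (upward closed) covers killed. With
    [l = x_1 + ... + x_n] and [k] of characteristic 0, [l : B_i -> B_(i+1)] is
    injective for [2i < n] and surjective for [2i + 2 > n]; surjectivity passes
    to [A_c]. The covers of a path have at least [m = n/2] (rounded down)
    elements, so injectivity also passes to [A_c] for [i < m - 1] and only
    [i = m - 1] is critical.

    For [n] odd there is a unique cover [V] of size [m], and [l B_(m-1)] does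
    not contain [x_V], because a product of differences [x_p - x_q] over
    disjoint pairs defines a functional that kills [l B_(m-1)] but not [x_V].
    For [n = 2m] and [m >= 3], let [l = sum a_j x_j]. An explicit combination
    of the [x_C], [#|C| = m - 1], weighted by [#|C :&: O|] for [O] the set of odd
    vertices, is mapped by [l] into the span of the covers [x_O] and
    [x_(~: O)]; and a product of binomials over a perfect matching none of
    whose transversals is a cover defines a functional on [A_m] that kills
    [l A_(m-1)]. So [l] is neither injective nor surjective there. *)

Require Import Defs.
From mathcomp Require Import all_boot all_algebra.
From mathcomp Require Import zify boolp mpoly.

Set Implicit Arguments.
Unset Strict Implicit.
Unset Printing Implicit Defensive.

Import GRing.Theory.

(** * Multiplication by a linear form on squarefree coefficients *)

Section SquarefreeCoefficients.
Local Open Scope ring_scope.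
Variables (k : fieldType) (n : nat).
Implicit Types (p q : {mpoly k[n]}) (C D : {set 'I_n}) (a : 'I_n -> k).

Definition linear_form a : {mpoly k[n]} := \sum_j a j *: 'X_j.

Definition up_map a (u : {set 'I_n} -> k) C : k :=
  \sum_(j in C) a j * u (C :\ j).

Lemma mcoeffMX_if p (m m' : 'X_{1..n}) :
  (p * 'X_[m])@_m' = if (m <= m')%MM then p@_(m' - m) else 0.
Proof.
case: ifP => [le_mm'|]; first by rewrite -[in LHS](submK le_mm') addmC mcoeffMX.
move=> le_mm'; rewrite [p]mpolyE mulr_suml raddf_sum big1 //= => m1 _.
rewrite -scalerAl mcoeffZ -mpolyXD mcoeffX; case: eqP => [E|]; rewrite ?mulr0 //.
by rewrite -E lem_addl in le_mm'.
Qed.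

Lemma lepm_mesym1 C D : (mesym1 C <= mesym1 D)%MM = (C \subset D).
Proof.
apply/mnm_lepP/subsetP => [le_CD i Ci|sCD i]; last first.
  by rewrite !mnmE; case: (boolP (i \in C)) => // /sCD ->.
by move: (le_CD i); rewrite !mnmE Ci; case: (i \in D).
Qed.

Lemma subm_mesym1 D j : (mesym1 D - U_(j))%MM = mesym1 (D :\ j).
Proof.
apply/mnmP => i; rewrite mnmBE mnm1E !mnmE !inE.
by case: eqVneq; case: (i \in D).
Qed.

Lemma mcoeff_linear_mul a p C :
  (linear_form a * p)@_(mesym1 C) = up_map a (fun D => p@_(mesym1 D)) C.
Proof.
rewrite mulrC mulr_sumr raddf_sum /= [RHS]big_mkcond; apply: eq_bigr => j _.
rewrite -scalerAr mcoeffZ mcoeffMX_if -mesym1_set1 lepm_mesym1 sub1set.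
by case: ifP; rewrite ?mulr0 // mesym1_set1 subm_mesym1.
Qed.

Lemma cover_monomialE C : cover_monomial k C = 'X_[mesym1 C].
Proof.
rewrite /cover_monomial mprodXE; congr 'X_[_]; apply/mnmP => i.
rewrite mnm_sumE mnmE; case: (boolP (i \in C)) => Ci.
  rewrite (bigD1 i) //= mnm1E eqxx big1 // => j /andP[_ /negbTE ji].
  by rewrite mnm1E ji.
rewrite big1 // => j Cj; rewrite mnm1E; case: eqP => // ji.
by rewrite -ji Cj in Ci.
Qed.

(** The ideal is monomial: no square and no cover monomial divides [x_C] for a non-cover [C], while
    any monomial with an exponent above 1 or with a cover as support is a multiple of a
    generator. *)
Lemma Ac_ideal_mcoeff (G : sgraph n) p :
  Ac_ideal k G p <->
  forall C, ~ vertex_cover G C -> p@_(mesym1 C) = 0.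
Proof.
split=> [[q [r [[s [hs ->]] [t [ht ->]] ->]]] C ncC|p0].
  rewrite mcoeffD !raddf_sum /= !big_seq !big1 ?addr0 // => b.
    case/ht => D covD ->; rewrite cover_monomialE mcoeffMX_if lepm_mesym1.
    case: ifP => // /subsetP sDC; case: ncC => i j Gij.
    by have /orP[/sDC->|/sDC->] := covD _ _ Gij; rewrite ?orbT.
  case/hs => i ->; rewrite mpolyXn mcoeffMX_if; case: ifP => // /mnm_lepP.
  by move/(_ i); rewrite mulmnE mnm1E eqxx mnmE; case: (i \in C).
have [I0 ID IM] := idealP (Ac_ideal k G).
have [S0 _ SM] := @ideal_gen_closed _ (fun p => exists i : 'I_n, p = 'X_i ^+ 2).
have [K0 _ KM] := @ideal_gen_closed _
  (fun p => exists2 C, vertex_cover G C & p = cover_monomial k C).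
have gen (S : {mpoly k[n]} -> Prop) q : S q -> ideal_gen S q.
  move=> Sq; exists [:: (1, q)]; split=> [b|]; first by rewrite inE => /eqP ->.
  by rewrite big_seq1 mul1r.
rewrite [p]mpolyE.
apply: (big_ind (fun q => Ac_ideal k G q)) => // m _.
have [le_m|] := boolP [forall i, m i <= 1]%N; last first.
  rewrite negb_forall => /existsP[i]; rewrite -ltnNge => lt1m.
  rewrite -mul_mpolyC; apply: IM; exists 'X_[m], 0; split=> //; last first.
    by rewrite addr0.
  have -> : m = (m - U_(i) *+ 2 + U_(i) *+ 2)%MM.
    apply/esym/submK/mnm_lepP => j; rewrite mulmnE mnm1E.
    by case: eqP => [<-|]; rewrite ?mul1n ?mul0n.
  by rewrite mpolyXD; apply: SM; apply: gen; exists i; rewrite mpolyXn.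
have -> : m = mesym1 [set i | m i != 0%N].
  apply/mnmP => i; rewrite mnmE inE; move/forallP/(_ i): le_m.
  by case: (m i) => [|[]].
set C := [set i | _]; case: (EM (vertex_cover G C)) => [covC|/p0->]; last first.
  by rewrite scale0r.
rewrite -mul_mpolyC; apply: IM; exists 0, 'X_[mesym1 C]; split=> //.
  by apply: gen; exists C; rewrite ?cover_monomialE.
by rewrite add0r.
Qed.

Lemma linear_form_homog a : linear_form a \is 1.-homog.
Proof.
by apply: rpred_sum => j _; apply: rpredZ; rewrite dhomogX /= mdeg1.
Qed.

Lemma homog1_linear_form p :
  p \is 1.-homog -> exists a, p = linear_form a.
Proof.
move=> hp; exists (fun j => p@_U_(j)); apply/mpolyP => m.
rewrite raddf_sum /=; have [/mdeg1P[i /eqP->]|dm] := boolP (mdeg m == 1%N).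
  rewrite (bigD1 i) //= mcoeffZ mcoeffXU eqxx mulr1 big1 ?addr0 // => j.
  by move=> /negbTE ji; rewrite mcoeffZ mcoeffXU ji mulr0.
rewrite (dhomog_nemf_coeff hp) // big1 // => j _; rewrite mcoeffZ mcoeffX.
by case: eqP => [jm|]; rewrite ?mulr0 //; rewrite -jm mdeg1 in dm.
Qed.

Definition squarefree_form (i : nat) (u : {set 'I_n} -> k) : {mpoly k[n]} :=
  \sum_(C : {set 'I_n} | #|C| == i) u C *: 'X_[mesym1 C].

Lemma squarefree_form_homog i u : squarefree_form i u \is i.-homog.
Proof.
apply: rpred_sum => C /eqP cC; apply: rpredZ.
by rewrite dhomogX /= mdeg_mesym1 cC.
Qed.

Lemma mcoeff_squarefree_form i u C :
  (squarefree_form i u)@_(mesym1 C) = if #|C| == i then u C else 0.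
Proof.
rewrite raddf_sum /=; case: ifP => [cC|ncC].
  rewrite (bigD1 C) //= mcoeffZ mcoeffX eqxx mulr1 big1 ?addr0 // => D.
  rewrite mcoeffZ mcoeffX (inj_eq (@inj_mesym1 n)) => /andP[_ /negbTE->].
  by rewrite mulr0.
rewrite big1 // => D /eqP cD; rewrite mcoeffZ mcoeffX (inj_eq (@inj_mesym1 n)).
by case: eqP => [DC|]; rewrite ?mulr0 // -DC cD eqxx in ncC *.
Qed.

Lemma eq_up_map a u v C :
  (forall D, #|D|.+1 = #|C| -> u D = v D) -> up_map a u C = up_map a v C.
Proof.
move=> uv; apply: eq_bigr => j Cj; congr (_ * _); apply: uv.
by rewrite (cardsD1 j C) Cj.
Qed.

Variable G : sgraph n.

(** Total functions [u] stand for elements of degree [i]: subsets of non-covers are non-covers, so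
    only values at non-covers of size [i] enter the equations. *)
Definition injective_at a i : Prop :=
  forall u, (forall C, ~ vertex_cover G C -> #|C| = i.+1 -> up_map a u C = 0) ->
  forall C, ~ vertex_cover G C -> #|C| = i -> u C = 0.

Definition surjective_at a i : Prop :=
  forall v, exists u, forall C,
    ~ vertex_cover G C -> #|C| = i.+1 -> up_map a u C = v C.

Lemma WLP_Ac :
  WLP (@Ac_piece k n G) <->
  exists a, forall i, injective_at a i \/ surjective_at a i.
Proof.
pose pi := quo_pi (Ac_ideal k G).
have pi_mul p q : pi p * pi q = pi (p * q) by rewrite /pi quo_pi_mul.
have piE p q : pi p = pi q <->
    forall C, ~ vertex_cover G C -> p@_(mesym1 C) = q@_(mesym1 C).
  rewrite /pi; split=> [/quo_piP/Ac_ideal_mcoeff h C /h|h].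
    by rewrite mcoeffB => /eqP; rewrite subr_eq0 => /eqP.
  apply/quo_piP/Ac_ideal_mcoeff => C /h; rewrite mcoeffB => ->.
  exact: subrr.
have coef0 i p C : p \is i.-homog -> #|C| <> i -> p@_(mesym1 C) = 0.
  move=> hp /eqP cC; apply: (dhomog_nemf_coeff hp).
  by rewrite /= mdeg_mesym1.
have hsub C j : ~ vertex_cover G C -> ~ vertex_cover G (C :\ j).
  move=> ncC cov; apply: ncC => i i' /cov; rewrite !inE.
  by case/orP=> /andP[_ ->]; rewrite ?orbT.
split=> [[_ [l /homog1_linear_form[a ->] ->] H]|[a H]].
  exists a => i; case: (H i) => {}H; [left=> u hu C ncC cC|right=> v].
    have /piE/(_ C ncC) : pi (squarefree_form i u) = pi 0.
      apply: H; first by exists (squarefree_form i u); first exact: squarefree_form_homog.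
        by exists 0; rewrite ?rpred0.
      rewrite !pi_mul; apply/piE => D ncD; rewrite mulr0 mcoeff0 mcoeff_linear_mul.
      have [cD|cD] := eqVneq #|D| i.+1.
        rewrite -[RHS](hu D) //; apply: eq_up_map => E.
        by rewrite cD mcoeff_squarefree_form => -[->]; rewrite eqxx.
      rewrite /up_map big1 // => j Dj; rewrite mcoeff_squarefree_form.
      by rewrite (cardsD1 j D) Dj add1n eqSS in cD; rewrite (negbTE cD) mulr0.
    by rewrite mcoeff_squarefree_form cC eqxx mcoeff0.
  have [|_ [p hp ->]] := H (pi (squarefree_form i.+1 v)).
    by exists (squarefree_form i.+1 v); first exact: squarefree_form_homog.
  rewrite pi_mul => /piE h; exists (fun D => p@_(mesym1 D)) => C ncC cC.
  by rewrite -mcoeff_linear_mul h // mcoeff_squarefree_form cC eqxx.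
exists (pi (linear_form a)).
  by exists (linear_form a); first exact: linear_form_homog.
move=> i; case: (H i) => {}H; [left=> _ _ [p hp ->] [q hq ->]|right=> _ [p hp ->]].
  rewrite !pi_mul => /piE h; apply/piE => C ncC.
  have [cC|/eqP cC] := eqVneq #|C| i; last by rewrite !(coef0 i).
  apply/eqP; rewrite -subr_eq0 -mcoeffB; apply/eqP.
  apply: (H (fun D => (p - q)@_(mesym1 D))) => // D ncD _.
  by rewrite -mcoeff_linear_mul mulrBr mcoeffB h // subrr.
have [u hu] := H (fun D => p@_(mesym1 D)).
exists (pi (squarefree_form i u)).
  by exists (squarefree_form i u); first exact: squarefree_form_homog.
rewrite pi_mul; apply/piE => C ncC; rewrite mcoeff_linear_mul.
have [cC|/eqP cC] := eqVneq #|C| i.+1.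
  rewrite -hu //; apply: eq_up_map => D.
  by rewrite cC mcoeff_squarefree_form => -[->]; rewrite eqxx.
rewrite (coef0 i.+1) // /up_map big1 // => j Cj; rewrite mcoeff_squarefree_form.
by move/eqP: cC; rewrite (cardsD1 j C) Cj eqSS => /negbTE->; rewrite mulr0.
Qed.

End SquarefreeCoefficients.

(** * Maximal rank in the Boolean lattice *)

Section BooleanLattice.
Local Open Scope ring_scope.
Variables (k : fieldType) (n : nat).
Implicit Types (C D E F G X : {set 'I_n}) (a b : 'I_n -> k).
Hypothesis char0 : [pchar k] =i pred0.

Lemma natr_neq0 t : (0 < t)%N -> t%:R != 0 :> k.
Proof. by move: char0 => /pcharf0P ->; case: t. Qed.

(* These are the entries, indexed by a distance [t], of one-sided inverses of
   the inclusion matrices of [B_i -> B_(i+1)]; [inv_coef_rec] says so. *)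
Fixpoint inv_coef (N t : nat) : k :=
  if t is t'.+1 then - (t%:R / (N - t)%:R) * inv_coef N t' else N%:R^-1.

Lemma inv_coef_rec N t : (t < N)%N ->
  t%:R * inv_coef N t.-1 + (N - t)%:R * inv_coef N t = (t == 0%N)%:R.
Proof.
case: t => [|t] ltN /=; first by rewrite mul0r add0r subn0 divff ?natr_neq0.
rewrite mulNr mulrN [X in _ - X]mulrA [(N - _)%:R * (_ / _)]mulrCA divff.
  by rewrite mulr1 subrr.
by rewrite natr_neq0 ?subn_gt0.
Qed.

Lemma inv_coef_neq0 N t : (t < N)%N -> inv_coef N t != 0.
Proof.
elim: t => [|t IH] ltN /=; first by rewrite invr_eq0 natr_neq0.
by rewrite mulf_neq0 ?IH 1?ltnW // oppr_eq0 mulf_neq0 ?invr_eq0 ?natr_neq0 ?subn_gt0.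
Qed.

(** Removing an element of [X] from [F] lowers the intersection by one, removing any other keeps it;
    this produces the two terms of [inv_coef_rec]. *)
Lemma sum_card_setID1 (g : nat -> k) X F :
  \sum_(j in F) g #|X :&: (F :\ j)| =
  #|X :&: F|%:R * g #|X :&: F|.-1 + (#|F| - #|X :&: F|)%:R * g #|X :&: F|.
Proof.
rewrite (bigID (mem X)) /=; congr (_ + _).
  rewrite (eq_bigr (fun=> g #|X :&: F|.-1)) => [|j /andP[Fj Xj]].
    rewrite sumr_const mulr_natl; congr (_ *+ _); apply: eq_card => j.
    by rewrite !inE andbC.
  by rewrite (cardsD1 j (X :&: F)) inE Xj Fj -setIDA.
rewrite (eq_bigr (fun=> g #|X :&: F|)) => [|j /andP[Fj Xj]].
  rewrite sumr_const mulr_natl [X :&: F]setIC -cardsD; congr (_ *+ _).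
  by apply: eq_card => j; rewrite !inE andbC.
congr (g #|pred_of_set _|); apply/setP => j'; rewrite !inE.
by case: eqP => // ->; rewrite (negbTE Xj).
Qed.

(** Double counting along [C = j |: G]; it pulls a functional [h] back along the linear form. *)
Lemma up_map_adjoint a (h u : {set 'I_n} -> k) i :
  \sum_(C : {set 'I_n} | #|C| == i.+1) h C * up_map a u C =
  \sum_(G : {set 'I_n} | #|G| == i) (\sum_(j in ~: G) a j * h (j |: G)) * u G.
Proof.
under eq_bigr do rewrite mulr_sumr; under [RHS]eq_bigr do rewrite mulr_suml.
rewrite (exchange_big_dep predT) //= [RHS](exchange_big_dep predT) //=.
apply: eq_bigr => j _.
rewrite (reindex_onto (fun G => j |: G) (fun C => C :\ j)) => [|C /andP[_ Cj]];
  last exact: setD1K.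
apply: eq_big => [G|G /andP[_ /eqP->]]; last by rewrite mulrCA mulrA.
rewrite !inE eqxx andbT cardsU1.
have [Gj|Gj] := boolP (j \in G); last by rewrite andbT setU1K ?eqxx ?andbT.
rewrite andbF; apply/negbTE/negP => /andP[_ /eqP/setP/(_ j)].
by rewrite !inE eqxx Gj.
Qed.

(** A left inverse has entries [inv_coef (n - i) #|F :&: ~: C|]; the recurrence is used at
    [t = #|F :&: ~: G|], at most [i], hence below [n - i]. *)
Lemma up_map_injective (u : {set 'I_n} -> k) i : (i.*2 < n)%N ->
  (forall C, #|C| = i.+1 -> up_map (fun=> 1) u C = 0) ->
  forall F, #|F| = i -> u F = 0.
Proof.
move=> lt_in hu F cF.
have := up_map_adjoint (fun=> 1) (fun C => inv_coef (n - i) #|F :&: ~: C|) u i.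
rewrite big1 => [|C /eqP /hu ->]; last by rewrite mulr0.
have E G : #|G| = i -> \sum_(j in ~: G) 1 * inv_coef (n - i) #|F :&: ~: (j |: G)|
                       = (F == G)%:R.
  move=> cG; under eq_bigr do rewrite mul1r setCU [~: [set _] :&: _]setIC -setDE.
  have := cardsC G; rewrite card_ord cG => cGC.
  have le_FG : (#|F :&: ~: G| <= #|F|)%N by rewrite subset_leq_card ?subsetIl.
  rewrite sum_card_setID1 (_ : #|~: G| = n - i)%N; last by lia.
  rewrite inv_coef_rec; last by lia.
  by rewrite cards_eq0 -setDE setD_eq0 eqEcard cF cG leqnn andbT.
rewrite (bigD1 F) ?cF //= E // eqxx mul1r big1 ?addr0 // => G /andP[/eqP cG].
by rewrite E // eq_sym => /negbTE->; rewrite mul0r.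
Qed.

(** Dually, a right inverse has entries [inv_coef i.+1 #|~: C :&: G|]; now [t] is at most
    [n - i.+1], hence below [i.+1]. *)
Lemma up_map_surjective (v : {set 'I_n} -> k) i : (n < i.+1.*2)%N ->
  exists u, forall E, #|E| = i.+1 -> up_map (fun=> 1) u E = v E.
Proof.
move=> lt_ni.
exists (fun G => \sum_(C : {set 'I_n} | #|C| == i.+1)
                    inv_coef i.+1 #|~: C :&: G| * v C) => E cE.
rewrite /up_map; under eq_bigr do rewrite mul1r.
rewrite exchange_big (bigD1 E) ?cE //= [X in _ + X]big1 ?addr0 => [|C /andP[/eqP cC CE]].
  rewrite -mulr_suml sum_card_setID1 setIC setICr cards0 subn0 mul0r add0r cE.
  by rewrite divff ?natr_neq0 // mul1r.
have := cardsC C; rewrite card_ord cC => cCC.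
have le_CC : (#|~: C :&: E| <= #|~: C|)%N by rewrite subset_leq_card ?subsetIl.
rewrite -mulr_suml sum_card_setID1 cE inv_coef_rec; last by lia.
rewrite cards_eq0 setIC -setDE setD_eq0.
by move: CE; rewrite eq_sym eqEcard cC cE leqnn andbT => /negbTE->; rewrite mul0r.
Qed.

End BooleanLattice.

(** * Functionals attached to a pairing of the variables *)

Section Transversals.
Local Open Scope ring_scope.
Variables (k : fieldType) (n : nat) (tau : 'I_n -> 'I_n).
Implicit Types (C G : {set 'I_n}) (a b : 'I_n -> k).
Hypotheses (char0 : [pchar k] =i pred0) (tauK : involutive tau).

(* [C] avoids the fixed points of [tau] and contains exactly one element of each
   pair [{j, tau j}]. *)
Definition pair_transversal C : bool :=
  [forall j, (j \in C) == (tau j != j) && (tau j \notin C)].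

Lemma transversal_swap G j :
  j \notin G -> pair_transversal (j |: G) ->
  [/\ tau j != j, tau j \notin G & pair_transversal (tau j |: G)].
Proof.
move=> Gj /forallP tG; have := eqP (tG j); rewrite !inE eqxx /= negb_or.
case/esym/and3P => tauj _ Gtau; split=> //.
apply/forallP => x; apply/eqP; have := eqP (tG x); rewrite !inE.
rewrite (inj_eq (inv_inj tauK)) -(inj_eq (inv_inj tauK) (tau x) j) tauK.
have jtau : (j == tau j) = false by rewrite eq_sym (negbTE tauj).
have [->|xj] := eqVneq x j; first by rewrite jtau (negbTE Gj) /= andbF.
have [->|//] := eqVneq x (tau j).
by rewrite tauK jtau (negbTE Gj).
Qed.

(** If one element completes [G] to a transversal, exactly two do, some [j] and [tau j], and their
    contributions cancel. *)
Lemma transversal_annihilates a b (u : {set 'I_n} -> k) i :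
  (forall j, tau j != j -> a j * b j + a (tau j) * b (tau j) = 0) ->
  \sum_(C : {set 'I_n} | #|C| == i.+1)
     (if pair_transversal C then \prod_(j in C) b j else 0) * up_map a u C = 0.
Proof.
move=> ab; rewrite up_map_adjoint big1 // => G _.
pose P j := (j \notin G) && pair_transversal (j |: G).
have P_tau j : P j = P (tau j).
  apply/idP/idP => /andP[Gj /(transversal_swap Gj)[_ Gt tG]].
    by rewrite /P Gt tG.
  by rewrite tauK in Gt tG; rewrite /P Gt tG.
set S := \sum_(j in _) _.
suff S0 : S = \sum_(j | P j) a j * b j * \prod_(i in G) b i.
  (* Adding the sum to its reindexing by [tau] avoids choosing a representative of the pair, at the
     cost of a factor 2. *)
  suff : S *+ 2 = 0.
    rewrite -mulr_natl => /eqP; rewrite mulf_eq0 (negbTE (natr_neq0 char0 _)) //=.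
    by move/eqP->; rewrite mul0r.
  rewrite mulr2n {1}S0 S0 [X in _ + X](reindex_inj (inv_inj tauK)).
  rewrite -(eq_bigl _ _ P_tau) -big_split big1 //= => j /andP[Gj tG].
  have [tj _ _] := transversal_swap Gj tG.
  by rewrite -mulrDl ab // mul0r.
rewrite [RHS]big_mkcondr; apply: eq_big => [j|j]; rewrite inE // => Gj.
by case: ifP => _; rewrite ?mulr0 // big_setU1 //= mulrA.
Qed.

Hypothesis tau_free : forall j, tau j != j.

Lemma transversal_card C : pair_transversal C -> #|C|.*2 = n.
Proof.
move=> /forallP tC; rewrite -addnn -[RHS](card_ord n) -(cardsC C); congr (_ + _)%N.
rewrite -(card_imset _ (inv_inj tauK)); congr #|pred_of_set _|.
apply/setP => j; rewrite inE; apply/imsetP/idP => [[i Ci ->]|Cj].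
  by have := eqP (tC i); rewrite Ci tau_free => /esym.
by exists (tau j); rewrite ?tauK // (eqP (tC _)) tauK eq_sym tau_free.
Qed.

Lemma transversal_weights a : exists b T,
  [/\ pair_transversal T, forall j, a j * b j + a (tau j) * b (tau j) = 0
    & forall j, j \in T -> b j != 0].
Proof.
pose b j : k := if (a j == 0) && (a (tau j) == 0) then 1
                else if (j < tau j)%N then a (tau j) else - a (tau j).
have lt_tau j : (tau j < j)%N = ~~ (j < tau j)%N.
  rewrite -leqNgt [RHS]leq_eqVlt (_ : (tau j == j :> nat) = false) //.
  exact/negbTE/tau_free.
exists b, [set j : 'I_n | if (j < tau j)%N then b j != 0 else b (tau j) == 0].
split=> [|j|j].
- apply/forallP => j; rewrite !inE tauK tau_free lt_tau.
  by case: ifP => //=; rewrite negbK.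
- rewrite /b tauK andbC; case: ifP => [/andP[/eqP-> /eqP->]|_].
    by rewrite !mul0r addr0.
  by rewrite lt_tau; case: ifP => _ /=; rewrite mulrN [a j * _]mulrC ?subrr ?addNr.
- rewrite inE; case: ifP => // ltj; rewrite /b tauK lt_tau ltj /= [(a j == 0) && _]andbC.
  case: (boolP (_ && _)) => [_|]; first by rewrite oner_eq0.
  by rewrite negb_and oppr_eq0 => h /eqP a0; rewrite a0 eqxx orbF in h.
Qed.

End Transversals.

(** * Minimal vertex covers of paths *)

Section PathCovers.
Variable n : nat.
Implicit Types C : {set 'I_n}.

Lemma path_coverP C :
  vertex_cover (path_graph n) C <->
  forall x, x.+1 < n -> exists2 j : 'I_n, j \in C & (j == x :> nat) || (j == x.+1 :> nat).
Proof.
split=> [cov x ltx|cov].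
  have /orP[Cj|Cj] : (Ordinal (ltnW ltx) \in C) || (Ordinal ltx \in C).
  - by apply: cov; rewrite /= /path_adj /= eqxx.
    by exists (Ordinal (ltnW ltx)); rewrite ?eqxx.
  by exists (Ordinal ltx); rewrite ?eqxx ?orbT.
have aux (i j : 'I_n) : i.+1 == j -> (i \in C) || (j \in C).
  move=> /eqP ij; have [|l Cl] := cov i; first by rewrite ij.
  by rewrite ij => /orP[]/eqP/val_inj<-; rewrite Cl ?orbT.
by move=> i j /orP[/aux|/aux]//; rewrite orbC.
Qed.

Lemma card_ge_image C (f : 'I_n -> nat) M :
  (forall p, p < M -> exists2 x, x \in C & f x = p) -> M <= #|C|.
Proof.
move=> surj; rewrite -(size_iota 0 M) cardE -(size_map f).
apply: uniq_leq_size => [|p]; first exact: iota_uniq.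
rewrite mem_iota => /surj[x Cx <-]; apply: map_f.
by rewrite mem_enum.
Qed.

(** The edges {2p, 2p+1} form a matching, and halving sends both ends of such an edge to [p]. *)
Lemma path_cover_card C : vertex_cover (path_graph n) C -> n./2 <= #|C|.
Proof.
move=> /path_coverP cov; apply: (card_ge_image (f := fun x => x./2)) => p ltp.
have [|x Cx xp] := cov p.*2; first by lia.
by exists x => //; lia.
Qed.

Lemma path_cover_min_odd C : odd n -> vertex_cover (path_graph n) C ->
  #|C| = n./2 -> C = [set j : 'I_n | odd j].
Proof.
move=> n_odd /path_coverP cov cC.
have Codd (j : 'I_n) : j \in C -> odd j.
  move=> Cj; apply: contraT => j_even.
  (* An even [j] in [C] leaves vertices that split into [n./2] disjoint edges, all met by [C]; the
     map below numbers these edges and {j} from left to right. *)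
  suff : (n./2).+1 <= #|C| by rewrite cC ltnn.
  apply: (card_ge_image (f := fun x => if x <= j then x./2 else x.+1./2)) => p ltp.
  have [ltpj|ltjp|/esym pj] := ltngtP p.*2 j; last first.
  - by exists j => //; rewrite leqnn pj doubleK.
  - have [|x Cx xp] := cov p.*2.-1; first by lia.
    by exists x => //; case: ifP; lia.
  have [|x Cx xp] := cov p.*2; first by have := ltn_ord j; lia.
  by exists x => //; case: ifP; lia.
apply/setP => j; rewrite inE; apply/idP/idP => [/Codd//|j_odd].
have [|x Cx xj] := cov j.-1; first by have := ltn_ord j; lia.
have x_odd := Codd _ Cx.
suff -> : j = x by [].
by apply: val_inj => /=; lia.
Qed.

(* The pairs are {0,1}, {2,3}, ...; for odd [n], [insubd] fixes the last vertex. *)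
Definition flip (j : 'I_n) : 'I_n := insubd j (if odd j then j.-1 else j.+1).

Lemma val_flip (j : 'I_n) :
  flip j = (if odd j then j.-1 else if j.+1 < n then j.+1 else j) :> nat.
Proof.
rewrite /flip val_insubd; case: (odd j) => //.
by rewrite (leq_ltn_trans (leq_pred _) (ltn_ord j)).
Qed.

Lemma flipK : involutive flip.
Proof.
move=> j; apply: val_inj; rewrite /= !val_flip; have := ltn_ord j.
by do ![case: ifP]; lia.
Qed.

Lemma odds_transversal : pair_transversal flip [set j : 'I_n | odd j].
Proof.
apply/forallP => j; rewrite !inE -val_eqE /= val_flip; have := ltn_ord j.
by do ![case: ifP]; lia.
Qed.

End PathCovers.

(** * Injectivity and surjectivity for paths, degree by degree *)

Section PathLefschetz.
Local Open Scope ring_scope.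
Variables (k : fieldType) (n : nat).
Implicit Types (C D F : {set 'I_n}) (a : 'I_n -> k).
Hypothesis char0 : [pchar k] =i pred0.

Local Notation cover := (vertex_cover (path_graph n)).
Local Notation injective_at := (@injective_at k n (path_graph n)).
Local Notation surjective_at := (@surjective_at k n (path_graph n)).

Lemma small_not_cover C : (#|C| < n./2)%N -> ~ cover C.
Proof. by move=> ltC /path_cover_card; rewrite leqNgt ltC. Qed.

Lemma surjective_at_ge i : (n < i.+1.*2)%N -> surjective_at (fun=> 1) i.
Proof.
by move=> lt_ni v; have [u hu] := up_map_surjective char0 v lt_ni; exists u => C _ /hu.
Qed.

Lemma injective_at_lt i : (i.+1 < n./2)%N -> injective_at (fun=> 1) i.
Proof.
move=> lt_in u hu C _; apply: (up_map_injective char0 (u := u)) => [|D cD].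
  by lia.
by apply: hu => //; apply: small_not_cover; rewrite cD.
Qed.

Lemma injective_at_odd i : odd n -> i.+1 = n./2 -> injective_at (fun=> 1) i.
Proof.
move=> n_odd iE u hu C _; apply: (up_map_injective char0 (u := u)); first by lia.
pose V : {set 'I_n} := [set j : 'I_n | odd j].
have hV D : #|D| = i.+1 -> D <> V -> up_map (fun=> 1) u D = 0.
  move=> cD DV; apply: hu => // covD; apply: DV.
  by apply: path_cover_min_odd; rewrite // cD.
move=> D cD; have [DV|/eqP/hV->//] := eqVneq D V; subst D.
(* [flip] changes parity on each pair, so these signs encode the differences x_p - x_q; only the
   term of [V] can survive. *)
pose b (j : 'I_n) : k := (-1) ^+ odd j.
have ab j : flip j != j -> 1 * b j + 1 * b (flip j) = 0.
  rewrite !mul1r /b -val_eqE /= => jn.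
  have -> : odd (flip j) = ~~ odd j by move: jn; rewrite !val_flip; do ![case: ifP]; lia.
  by case: (odd j); rewrite ?addrN ?addNr.
have := transversal_annihilates (a := fun=> 1) char0 (@flipK n) u i ab.
rewrite (bigD1 V) ?cD //= odds_transversal [X in _ + X]big1
  => [|E /andP[/eqP cE /eqP EV]].
  rewrite addr0 => /eqP; rewrite mulf_eq0 prodf_seq_eq0 => /orP[/hasP[j _]|/eqP//].
  by rewrite signr_eq0 andbF.
by rewrite hV ?mulr0.
Qed.

(** Take a prefix of a list with [Z] before its complement. With [Z] the support of a linear form,
    this separates the two kernel constructions. *)
Lemma exists_card_comparable (Z : {set 'I_n}) r : (r <= n)%N ->
  exists2 C : {set 'I_n}, #|C| = r & (C \subset Z) || (Z \subset C).
Proof.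
move=> le_rn; pose s := enum Z ++ enum (~: Z).
have size_s : size s = n by rewrite size_cat -!cardE cardsC card_ord.
have uniq_s : uniq s.
  rewrite cat_uniq !enum_uniq andbT; apply/hasPn => j.
  by rewrite !mem_enum inE.
exists [set j in take r s].
  rewrite cardsE; have /card_uniqP-> := take_uniq r uniq_s.
  by rewrite size_takel ?size_s.
rewrite take_cat; case: ifP => _; apply/orP; [left|right]; apply/subsetP => j.
  by rewrite inE => /mem_take; rewrite mem_enum.
by rewrite inE mem_cat mem_enum => ->.
Qed.

(* If fewer than [m] of the [a j] are nonzero, [x_C] with [C] containing the
   support of [a] is in the kernel; otherwise the combination of the [x_C]
   weighted by [inv_coef k m.+1 #|O :&: C|] is, because the recurrence for
   [inv_coef] is inhomogeneous only at the two covers [O] and [~: O]. *)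
Lemma not_injective_at_even a m : n = m.+1.*2 -> ~ injective_at a m.
Proof.
move=> nE inj; have n2 : n./2 = m.+1 by rewrite nE doubleK.
have [|C cC CZ] := @exists_card_comparable [set j | a j != 0] m; first by lia.
have ncC : ~ cover C by apply: small_not_cover; rewrite cC n2.
have [Ca|] := boolP (C \subset [set j | a j != 0]); last first.
  case/subsetPn => x Cx; rewrite inE negbK => ax.
  have {}CZ : [set j | a j != 0] \subset C.
    case/orP: CZ => // /subsetP/(_ x Cx).
    by rewrite inE ax.
  suff /(_ C ncC cC)/eqP : forall D, ~ cover D -> #|D| = m -> (D == C)%:R = 0 :> k.
    by rewrite eqxx oner_eq0.
  apply: inj => D _ _; rewrite /up_map big1 // => j Dj.
  case: eqP => [DC|]; rewrite ?mulr0 // mulr1; apply/eqP; apply: contraT => aj.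
  by have := subsetP CZ j; rewrite inE -DC !inE eqxx => /(_ aj).
pose O : {set 'I_n} := [set j : 'I_n | odd j].
have edge_parity (P : pred nat) (Q : {set 'I_n}) :
    (forall j, (j \in Q) = P j) -> (forall x, P x || P x.+1) -> cover Q.
  move=> QP PP i j /orP[]/eqP ij; rewrite !QP -ij //.
  by rewrite orbC.
have covO : cover O by apply: (edge_parity odd) => [j|x]; rewrite ?inE //=; case: odd.
have covOC : cover (~: O).
  by apply: (edge_parity (fun x => ~~ odd x)) => [j|x]; rewrite ?inE //=; case: odd.
have flip_free (j : 'I_n) : flip j != j.
  by rewrite -val_eqE /= val_flip; have := ltn_ord j; do ![case: ifP]; lia.
have cO : #|O| = m.+1.
  by have := transversal_card (@flipK n) flip_free (odds_transversal n); rewrite -/O; lia.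
have cOC : #|~: O| = m.+1 by have := cardsC O; rewrite card_ord; lia.
(* The product of the [a j] rescales the variables: [a j] times the product over [F :\ j] is the
   product over [F], so unit coefficients remain. *)
pose u D := \prod_(j in D) a j * inv_coef k m.+1 #|O :&: D|.
have /eqP : u C = 0.
  apply: (inj u) => // F ncF cF; rewrite /up_map /u.
  rewrite (eq_bigr (fun j =>
    \prod_(l in F) a l * inv_coef k m.+1 #|O :&: (F :\ j)|)); last first.
    by move=> j Fj; rewrite (big_setD1 j Fj) /= mulrA.
  rewrite -mulr_sumr sum_card_setID1 cF.
  have ltOF : (#|O :&: F| < m.+1)%N.
    rewrite ltn_neqAle -{2}cO subset_leq_card ?subsetIl // andbT.
    apply/eqP => cOF; apply: ncF; suff -> : F = O by [].
    apply/esym/eqP; rewrite eqEcard cO cF leqnn andbT.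
    by apply/setIidPl/eqP; rewrite eqEcard subsetIl cOF cO /=.
  rewrite inv_coef_rec //; case: eqP => [/cards0_eq OF0|_]; last by rewrite mulr0.
  case: ncF; suff -> : F = ~: O by [].
  apply/eqP; rewrite eqEcard cF cOC leqnn andbT.
  by rewrite -setD_eq0 setDE setCK setIC OF0.
rewrite mulf_eq0 (negbTE (inv_coef_neq0 char0 _)) ?orbF.
  rewrite prodf_seq_eq0 => /hasP[j _ /andP[Cj aj]].
  by have := subsetP Ca j Cj; rewrite inE aj.
by rewrite ltnS -cC subset_leq_card ?subsetIr.
Qed.

(* On the path 0 - ... - 5 a cover containing exactly one vertex of each of the
   pairs {0,5}, {1,3}, {2,4} would have to omit both ends of an edge. *)
Definition nested_matching_nat (x : nat) : nat :=
  match x with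
  | 0 => 5 | 1 => 3 | 2 => 4 | 3 => 1 | 4 => 2 | 5 => 0
  | _ => if odd x then x.-1 else x.+1
  end.

Definition nested_matching (j : 'I_n) : 'I_n := insubd j (nested_matching_nat j).

(** All transversals of [nested_matching] are non-covers, so the functional lives on [A_c]; it kills
    the image but not [x_T], as the weights on [T] are nonzero. *)
Lemma not_surjective_at_even a m : n = m.+1.*2 -> (2 <= m)%N -> ~ surjective_at a m.
Proof.
move=> nE le2m surj.
(* As [n] is even and at least 6, the default of [insubd] is never taken. *)
have val_tau (j : 'I_n) : nested_matching j = nested_matching_nat j :> nat.
  rewrite /nested_matching val_insubd; case: ifP => // /negP[].
  case: j => [] [|[|[|[|[|[|x]]]]]] ltx /=; try lia.
  by rewrite negbK; case: ifP; lia.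
have tauK : involutive nested_matching.
  move=> j; apply: val_inj; rewrite /= !val_tau.
  case: j => [] [|[|[|[|[|[|x]]]]]] ltx //=.
  rewrite !negbK; case: ifP => [/= x_odd|x_even]; last by rewrite /= x_even.
  by case: x x_odd {ltx} => // x /=; case: x => [|x] //=; rewrite negbK => ->.
have tau_free (j : 'I_n) : nested_matching j != j.
  rewrite -val_eqE /= val_tau; case: j => [] [|[|[|[|[|[|x]]]]]] ltx //=.
  by case: ifP; lia.
have [b [T [tT ab bT]]] := transversal_weights tauK tau_free a.
have card_tr C : pair_transversal nested_matching C -> #|C| = m.+1.
  by move/(transversal_card tauK tau_free); lia.
have not_cover_tr C : pair_transversal nested_matching C -> ~ cover C.
  move=> /forallP tC cov; have le6n : (6 <= n)%N by lia.
  pose o x (ltx : (x < 6)%N) : 'I_n := Ordinal (leq_trans ltx le6n).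
  have edge x (ltx : (x < 6)%N) (ltx1 : (x.+1 < 6)%N) :
      (o x ltx \in C) || (o _ ltx1 \in C).
    by apply: cov; rewrite /= /path_adj /= eqxx.
  have pair x y (ltx : (x < 6)%N) (lty : (y < 6)%N) :
      nested_matching_nat x = y -> (o x ltx \in C) = (o y lty \notin C).
    move=> xy; rewrite (eqP (tC _)) tau_free /=; congr (_ \notin C).
    by apply: val_inj; rewrite /= val_tau.
  have := edge 0 isT isT; have := edge 1 isT isT; have := edge 2 isT isT.
  have := edge 3 isT isT; have := edge 4 isT isT.
  rewrite (pair 0 5 isT isT) // (pair 1 3 isT isT) // (pair 2 4 isT isT) //.
  by do 3!case: (_ \in C).
have [u hu] := surj (fun C => (C == T)%:R).
have := transversal_annihilates (a := a) (b := b) char0 tauK u m (fun j _ => ab j).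
rewrite (bigD1 T) ?card_tr //= tT [X in _ + X]big1 => [|C /andP[/eqP cC CT]]; last first.
  case: ifP => [tC|_]; last by rewrite mul0r.
  by rewrite hu ?(negbTE CT) ?mulr0 //; apply: not_cover_tr.
rewrite addr0 hu ?card_tr //; last exact: not_cover_tr.
move/eqP; rewrite eqxx mulr1 prodf_seq_eq0 => /hasP[j _ /andP[Tj]].
by rewrite (negbTE (bT j Tj)).
Qed.

End PathLefschetz.

(** * The paths with two and four vertices *)

Section SmallPaths.
Local Open Scope ring_scope.
Variables (k : fieldType).

Lemma path_not_coverP n (C : {set 'I_n}) :
  ~ vertex_cover (path_graph n) C ->
  exists i j : 'I_n, [/\ i.+1 = j, i \notin C & j \notin C].
Proof.
move=> ncC; apply: contrapT => noij; apply: ncC => i j ij.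
apply: contraT; rewrite negb_or => /andP[iC jC]; case: noij.
by case/orP: ij => /eqP; [exists i, j|exists j, i].
Qed.

Lemma card_disjoint_le n (A C : {set 'I_n}) : A \subset ~: C -> (#|A| + #|C| <= n)%N.
Proof.
by move=> AC; rewrite -[leqRHS](card_ord n) -(cardsC C) addnC leq_add2l subset_leq_card.
Qed.

Lemma up_map_set2 n (u : {set 'I_n} -> k) (p q : 'I_n) : p != q ->
  up_map (fun=> 1) u [set p; q] = u [set q] + u [set p].
Proof.
move=> pq; have qp : p \notin [set q] by rewrite inE.
rewrite /up_map big_setU1 //= big_set1 !mul1r setU1K // setUC setU1K //.
by rewrite inE eq_sym.
Qed.

(** Each single vertex covers the only edge, so the target is zero. *)
Lemma surjective_at_two : @surjective_at k 2 (path_graph 2) (fun=> 1) 0.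
Proof.
move=> v; exists (fun=> 0) => C /path_not_coverP[i [j [ij iC jC]]] cC.
have /card_disjoint_le : [set i; j] \subset ~: C.
  by apply/subsetP => l /set2P[]->; rewrite inE.
by rewrite cards2 cC -val_eqE /= -ij neq_ltn ltnSn.
Qed.

Lemma surjective_at_four : @surjective_at k 4 (path_graph 4) (fun=> 1) 1.
Proof.
move=> v; pose o x (ltx : (x < 4)%N) : 'I_4 := Ordinal ltx.
pose o0 := o 0 isT; pose o1 := o 1 isT; pose o2 := o 2 isT; pose o3 := o 3 isT.
(* The non-covers of size 2 are the complements of the three edges; their equations are solved
   starting from the value 0 at [[set o0]]. *)
exists (fun D : {set 'I_4} => if o1 \in D then v [set o0; o1] else
                 if o3 \in D then v [set o0; o3] else
                 if o2 \in D then v [set o2; o3] - v [set o0; o3] else 0).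
move=> C /path_not_coverP[i [j [ij iC jC]]] cC.
have inC l : l != i -> l != j -> l \in C.
  move=> li lj; apply: contraT => lC.
  have /card_disjoint_le : l |: [set i; j] \subset ~: C.
    by apply/subsetP => l'; rewrite !inE => /or3P[]/eqP->.
  rewrite cardsU1 cards2 !inE negb_or li lj cC.
  by rewrite -val_eqE /= -ij neq_ltn ltnSn.
have CE p q : p != q -> p \in C -> q \in C -> C = [set p; q].
  move=> pq Cp Cq; apply/esym/eqP; rewrite eqEcard cards2 pq cC leqnn andbT.
  by apply/subsetP => l /set2P[]->.
case: i ij iC inC => -[|[|[|x]]] ltx /= ij _ inC.
- rewrite (CE o2 o3) ?inC -?val_eqE /= -?ij // up_map_set2 // !inE /=.
  by rewrite addrC subrK.
- by rewrite (CE o0 o3) ?inC -?val_eqE /= -?ij // up_map_set2 // !inE /= addr0.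
- by rewrite (CE o0 o1) ?inC -?val_eqE /= -?ij // up_map_set2 // !inE /= addr0.
by have := ltn_ord j; rewrite -ij; case: x {ltx ij inC}.
Qed.

End SmallPaths.

Theorem theorem4p6 (k : fieldType) (chark : [pchar k]%R =i pred0)
    (n : nat) (n_ge2 : 2 <= n) :
  WLP (@Ac_piece k n (path_graph n)) <-> odd n \/ n <= 5.
Proof.
rewrite WLP_Ac; split=> [[a H]|n_small].
  have [n_odd|n_even] := boolP (odd n); first by left.
  have [|lt5n] := leqP n 5; first by right.
  have nE : n = n./2.-1.+1.*2 by lia.
  case: (H n./2.-1) => [/(not_injective_at_even chark nE)//|].
  by move/(not_surjective_at_even chark nE); case; lia.
exists (fun=> 1%R) => i.
have [lt_ni|le_in] := ltnP n i.+1.*2; first by right; apply: surjective_at_ge.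
have [lt_in|ge_in] := ltnP i.+1 n./2; first by left; apply: injective_at_lt.
(* Only the degree just below that of the smallest covers remains. *)
have iE : i.+1 = n./2 by lia.
have [n_odd|n_even] := boolP (odd n); first by left; apply: injective_at_odd.
right; have {n_small} : n = 2 \/ n = 4 by lia.
case=> nE; subst n; case: iE => ->; [exact: surjective_at_two|exact: surjective_at_four].
Qed.
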